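(* Let $\mathcal{S}_1$ and $\mathcal{S}_2$ be two descriptional systems (with associated complexity measures $c_1$ and $c_2$) that are effective trios. If (1) $\mathcal{S}_1$ has a decidable word problem but an undecidable emptiness problem, and (2) $\mathcal{S}_2$ has a decidable emptiness problem, then the trade-off between $\mathcal{S}_1$ and $\mathcal{S}_2$ is non-recursive.
   Context: A descriptional system $\mathcal{S}$ is a recursive set of non-empty finite descriptors, such that each descriptor $D\in\mathcal{S}$ describes a formal language $L(D)$, and if $L(D)$ is recursive (recursively enumerable), then there exists an effective procedure to convert $D$ into a Turing machine that decides (semi-decides) $L(D)$. Every descriptional system is taken to be at most recursively enumerable, i.e. all languages it describes are recursively enumerable. Put $\mathscr{L}(\mathcal{S})=\{L(D)\mid D\in\mathcal{S}\}$ and $\mathcal{S}(L)=\{D\in\mathcal{S}\mid L(D)=L\}$. A complexity measure for $\mathcal{S}$ is a total recursive function $c:\mathcal{S}\to\mathbb{N}$ such that for any alphabet $A$, the set of descriptors in $\mathcal{S}$ describing languages over $A$ is recursively enumerable in order of increasing size, and does not contain infinitely many descriptors of the same size. A total function $f:\mathbb{N}\to\mathbb{N}$ with $f(n)\ge n$ is an upper bound for the increase in complexity when changing from a descriptor in $\mathcal{S}_1$ to an equivalent descriptor in $\mathcal{S}_2$ if for all $D_1\in\mathcal{S}_1$ with $L(D_1)\in\mathscr{L}(\mathcal{S}_2)$ there exists $D_2\in\mathcal{S}_2(L(D_1))$ such that $c_2(D_2)\le f(c_1(D_1))$. The trade-off between $\mathcal{S}_1$ and $\mathcal{S}_2$ is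 non-recursive if there is no recursive upper bound. $\mathcal{S}$ is effectively closed under a language operation if there is an effective construction that, given descriptors from $\mathcal{S}$ for the arguments, yields a descriptor from $\mathcal{S}$ for the result; it is effectively closed under intersection with regular sets if there is an effective procedure that, given $D\in\mathcal{S}$ and a regular language $R$, constructs a descriptor from $\mathcal{S}$ for $L(D)\cap R$. $\mathcal{S}$ is an effective trio if it is effectively closed under $\lambda$-free morphism ($\lambda$ is the empty word), inverse morphism and intersection with regular languages. As usual, trios are understood to contain a non-empty language, so that $\mathscr{L}(\mathcal{S}_1)\cap\mathscr{L}(\mathcal{S}_2)$ contains all $\lambda$-free regular languages if both systems are trios. The word problem for $\mathcal{S}$ is: given $D\in\mathcal{S}$ and a word $w$, is $w\in L(D)$? The emptiness problem for $\mathcal{S}$ is: given $D\in\mathcal{S}$, is $L(D)=\emptyset$? *)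

(* Defs.v *)
From HB Require Import structures.
From mathcomp Require Import all_boot.

Set Implicit Arguments.
Unset Strict Implicit.
Unset Printing Implicit Defensive.

(** * Effective procedures: partial recursive functions *)

(* Terms for the mu-recursive functions.  Arities are left implicit: arguments
   come in a list and a missing argument counts as 0. *)
Inductive recfun : Type :=
| RZero
| RSucc
| RProj of nat
| RComp of recfun & seq recfun
| RPrec of recfun & recfun
| RMin of recfun.

(* [rec_sem p v y]: p halts on the arguments v with value y.
   - RPrec g h is the function F with F(0, v) = g(v) and
     F(n+1, v) = h(n, F(n, v), v);
   - RMin g maps v to the least y with g(y, v) = 0, provided that g(i, v) is
     defined for all i <= y. *)
Fixpoint rec_sem (p : recfun) (v : seq nat) (y : nat) {struct p} : Prop :=
  match p with
  | RZero => y = 0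
  | RSucc => y = (head 0 v).+1
  | RProj i => y = nth 0 v i
  | RComp g hs =>
      exists zs : seq nat,
        (fix all_sem (hs : seq recfun) (zs : seq nat) {struct hs} : Prop :=
           match hs, zs with
           | [::], [::] => True
           | h :: hs', z :: zs' => rec_sem h v z /\ all_sem hs' zs'
           | _, _ => False
           end) hs zs
        /\ rec_sem g zs y
  | RPrec g h =>
      (fix prec (n : nat) (y : nat) {struct n} : Prop :=
         match n with
         | 0 => rec_sem g (behead v) y
         | n'.+1 => exists z, prec n' z /\ rec_sem h [:: n', z & behead v] y
         end) (head 0 v) y
  | RMin g =>
      rec_sem g (y :: v) 0
      /\ forall i, i < y -> exists z, rec_sem g (i :: v) z.+1
  end.

Definition total_recursive (f : nat -> nat) : Prop :=
  exists p, forall n, rec_sem p [:: n] (f n).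

(* Finite objects are presented to procedures through [pickle].  It is used only
   at types built from nat, bool, option, pairs and sequences (and records
   isomorphic to such types), where it is a concrete Goedel numbering by
   [CodeSeq.code].

   [effective dom spec]: some procedure halts on every input x satisfying dom
   and returns a y with spec x y; nothing is required outside dom. *)
Definition effective (T U : countType) (dom : T -> Prop)
    (spec : T -> U -> Prop) : Prop :=
  exists p, forall x, dom x ->
    exists y, rec_sem p [:: pickle x] (pickle y) /\ spec x y.

Definition decidable_on (T : countType) (dom P : T -> Prop) : Prop :=
  exists p, forall x, dom x ->
    exists b : bool, rec_sem p [:: pickle x] (nat_of_bool b) /\ (b <-> P x).

(** * Words, alphabets, languages *)

(* The symbols are the natural numbers. *)
Definition word := seq nat.

(* An alphabet is a non-empty finite set of symbols, given by its increasing
   enumeration, so that equality of alphabets is Leibniz equality. *)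
Definition is_alphabet (A : seq nat) : bool := (A != [::]) && sorted ltn A.

Definition over (A : seq nat) (w : word) : bool := all (mem A) w.

(* A formal language comes with the alphabet over which it is a language. *)
Record language := Language {
  alph : seq nat;
  words :> word -> Prop
}.

Definition wf_language (L : language) : Prop :=
  is_alphabet (alph L) /\ forall w, words L w -> over (alph L) w.

Definition lang_eq (L1 L2 : language) : Prop :=
  alph L1 = alph L2 /\ forall w, L1 w <-> L2 w.

(* First value associated with a key in a finite table. *)
Definition lookup (K : eqType) (V : Type) (t : seq (K * V)) (k : K) : option V :=
  ohead [seq e.2 | e <- t & e.1 == k].

(** * Turing machines *)

(* Deterministic one-tape machines.  States are natural numbers, tape symbols
   are input symbols or other natural numbers (Some a) or the blank (None).
   A rule ((q, s), (q', s', m)) rewrites s into s', and moves right if m = true,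
   left if m = false; for each (q, s) only the first matching rule counts. *)
Record tm := TM {
  tm_alph : seq nat;
  tm_start : nat;
  tm_accept : seq nat;
  tm_rules : seq ((nat * option nat) * (nat * option nat * bool))
}.

Definition tm_tuple (M : tm) :=
  (tm_alph M, (tm_start M, (tm_accept M, tm_rules M))).
Definition tuple_tm u := let: (a, (s, (f, r))) := u in TM a s f r.
Lemma tm_tupleK : cancel tm_tuple tuple_tm. Proof. by case. Qed.
HB.instance Definition _ := Countable.copy tm (can_type tm_tupleK).

(* State, tape to the left of the head (nearest cell first), tape from the
   head on (scanned cell first); the rest of the two-way infinite tape is
   blank. *)
Definition tm_config : Type := nat * seq (option nat) * seq (option nat).

Definition tm_init (M : tm) (w : word) : tm_config :=
  (tm_start M, [::], map Some w).

Definition tm_step (M : tm) (c : tm_config) : option tm_config :=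
  let: (q, l, r) := c in
  match lookup (tm_rules M) (q, head None r) with
  | None => None
  | Some (q', s', true) => Some (q', s' :: l, behead r)
  | Some (q', s', false) => Some (q', behead l, head None l :: s' :: behead r)
  end.

(* M started on w halts (no rule applies) in state q. *)
Definition tm_halts_in (M : tm) (w : word) (q : nat) : Prop :=
  exists n l r,
    iter n (obind (tm_step M)) (Some (tm_init M w)) = Some (q, l, r)
    /\ tm_step M (q, l, r) = None.

Definition tm_accepts (M : tm) (w : word) : Prop :=
  exists2 q, q \in tm_accept M & tm_halts_in M w q.

Definition tm_semidecides (M : tm) (L : language) : Prop :=
  tm_alph M = alph L /\
  forall w, over (alph L) w -> (L w <-> tm_accepts M w).

Definition tm_decides (M : tm) (L : language) : Prop :=
  tm_semidecides M L /\
  forall w, over (alph L) w -> exists q, tm_halts_in M w q.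

Definition recursive_language (L : language) : Prop :=
  exists M, tm_decides M L.

(** * Regular languages and morphisms as inputs of procedures *)

(* Deterministic finite automata, with a possibly partial transition table
   (first matching entry; a missing transition rejects). *)
Record dfa := DFA {
  dfa_start : nat;
  dfa_final : seq nat;
  dfa_trans : seq ((nat * nat) * nat)
}.

Definition dfa_tuple (M : dfa) := (dfa_start M, (dfa_final M, dfa_trans M)).
Definition tuple_dfa u := let: (s, (f, t)) := u in DFA s f t.
Lemma dfa_tupleK : cancel dfa_tuple tuple_dfa. Proof. by case. Qed.
HB.instance Definition _ := Countable.copy dfa (can_type dfa_tupleK).

Definition dfa_run (M : dfa) (w : word) : option nat :=
  foldl (fun oq a => obind (fun q => lookup (dfa_trans M) (q, a)) oq)
    (Some (dfa_start M)) w.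

Definition dfa_accepts (M : dfa) (w : word) : bool :=
  if dfa_run M w is Some q then q \in dfa_final M else false.

(* A morphism mor_dom^* -> mor_cod^*; mor_img lists the images of the symbols
   of mor_dom, in increasing order of the symbols. *)
Record mor := Mor {
  mor_dom : seq nat;
  mor_cod : seq nat;
  mor_img : seq word
}.

Definition mor_tuple (h : mor) := (mor_dom h, (mor_cod h, mor_img h)).
Definition tuple_mor u := let: (a, (b, i)) := u in Mor a b i.
Lemma mor_tupleK : cancel mor_tuple tuple_mor. Proof. by case. Qed.
HB.instance Definition _ := Countable.copy mor (can_type mor_tupleK).

Definition wf_mor (h : mor) : bool :=
  [&& is_alphabet (mor_dom h), is_alphabet (mor_cod h),
      size (mor_img h) == size (mor_dom h)
    & all (over (mor_cod h)) (mor_img h)].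

Definition lambda_free (h : mor) : bool := all (predC1 [::]) (mor_img h).

Definition mor_apply (h : mor) (w : word) : word :=
  flatten [seq nth [::] (mor_img h) (index a (mor_dom h)) | a <- w].

Definition image_language (h : mor) (L : language) : language :=
  Language (mor_cod h) (fun w => exists2 u, L u & w = mor_apply h u).

Definition preimage_language (h : mor) (L : language) : language :=
  Language (mor_dom h) (fun w => over (mor_dom h) w /\ L (mor_apply h w)).

(* L intersected with the regular language over alph L recognised by M. *)
Definition inter_regular (L : language) (M : dfa) : language :=
  Language (alph L) (fun w => L w /\ dfa_accepts M w).

(** * Descriptional systems *)

(* Descriptors are words.  [ds_lang] is meaningful on [ds_mem] only. *)
Record desc_system := DescSystem {
  ds_mem : word -> Prop;
  ds_lang : word -> language;
  ds_nonempty : forall D, ds_mem D -> D != [::];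
  ds_recursive : decidable_on (fun _ => True) ds_mem;
  ds_wf : forall D, ds_mem D -> wf_language (ds_lang D);
  ds_semidecider :
    effective ds_mem (fun D M => tm_semidecides M (ds_lang D));
  ds_decider :
    (forall D, ds_mem D -> recursive_language (ds_lang D)) ->
    effective ds_mem (fun D M => tm_decides M (ds_lang D))
}.

(* D is a descriptor of the system S for the language L. *)
Definition describes (S : desc_system) (L : language) (D : word) : Prop :=
  ds_mem S D /\ lang_eq (ds_lang S D) L.

(* L belongs to the family of languages described by S. *)
Definition in_family (S : desc_system) (L : language) : Prop :=
  exists D, describes S L D.

(* D is a descriptor of S describing a language over the alphabet A. *)
Definition desc_over (S : desc_system) (A : seq nat) (D : word) : Prop :=
  ds_mem S D /\ alph (ds_lang S D) = A.

(* Recursive enumeration of P in order of increasing size c: the domain of the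
   enumerating procedure is an initial segment of nat, possibly all of it or
   empty. *)
Definition re_by_size (P : word -> Prop) (c : word -> nat) : Prop :=
  exists p,
    [/\ forall i y, rec_sem p [:: i] y -> exists2 D, P D & y = pickle D,
        forall D, P D -> exists i, rec_sem p [:: i] (pickle D),
        forall i j y, i <= j -> rec_sem p [:: j] y ->
          exists z, rec_sem p [:: i] z
      & forall i j D E, i <= j ->
          rec_sem p [:: i] (pickle D) -> rec_sem p [:: j] (pickle E) ->
          c D <= c E].

Definition complexity_measure (S : desc_system) (c : word -> nat) : Prop :=
  effective (ds_mem S) (fun D n => n = c D) /\
  forall A, is_alphabet A ->
    re_by_size (desc_over S A) c /\
    forall n, exists s : seq word,
      forall D, desc_over S A D -> c D = n -> D \in s.

Definition upper_bound (S1 : desc_system) (c1 : word -> nat)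
    (S2 : desc_system) (c2 : word -> nat) (f : nat -> nat) : Prop :=
  (forall n, n <= f n) /\
  forall D1, ds_mem S1 D1 -> in_family S2 (ds_lang S1 D1) ->
    exists2 D2, describes S2 (ds_lang S1 D1) D2 & c2 D2 <= f (c1 D1).

Definition nonrecursive_tradeoff (S1 : desc_system) (c1 : word -> nat)
    (S2 : desc_system) (c2 : word -> nat) : Prop :=
  ~ exists f, total_recursive f /\ upper_bound S1 c1 S2 c2 f.

(** * Closure properties and decision problems *)

Definition eff_closed_lambda_free_mor (S : desc_system) : Prop :=
  effective
    (fun x : word * mor =>
       [/\ ds_mem S x.1, wf_mor x.2, lambda_free x.2
         & alph (ds_lang S x.1) = mor_dom x.2])
    (fun x D => describes S (image_language x.2 (ds_lang S x.1)) D).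

Definition eff_closed_inverse_mor (S : desc_system) : Prop :=
  effective
    (fun x : word * mor =>
       [/\ ds_mem S x.1, wf_mor x.2 & alph (ds_lang S x.1) = mor_cod x.2])
    (fun x D => describes S (preimage_language x.2 (ds_lang S x.1)) D).

Definition eff_closed_inter_regular (S : desc_system) : Prop :=
  effective
    (fun x : word * dfa => ds_mem S x.1)
    (fun x D => describes S (inter_regular (ds_lang S x.1) x.2) D).

Definition effective_trio (S : desc_system) : Prop :=
  [/\ eff_closed_lambda_free_mor S, eff_closed_inverse_mor S,
      eff_closed_inter_regular S
    & exists D w, ds_mem S D /\ ds_lang S D w].

Definition decidable_word_problem (S : desc_system) : Prop :=
  decidable_on (fun x : word * word => ds_mem S x.1)
    (fun x => ds_lang S x.1 x.2).

Definition decidable_emptiness (S : desc_system) : Prop :=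
  decidable_on (ds_mem S) (fun D => forall w, ~ ds_lang S D w).

(* Main.v *)
(* Let D be a descriptor of S1.  Its language is mapped to one over {0} by
   sending each letter to 0, padded by the inverse of a morphism that erases a
   new letter, and mapped to {0} again.  The resulting descriptor D' describes
   {0^m : m >= k}, where k is the length of a shortest word of L(D), or the
   empty language if L(D) is empty.  For k > 0 the set {0^m : m >= k} belongs to
   every trio.  So a recursive bound f gives D2 in S2 equivalent to D' with
   c2(D2) <= f(c1(D')).  Since S2 has a decidable emptiness problem, hence a
   decidable word problem, some recursive B is such that every descriptor over
   {0} of size at most n in S2 describing a non-empty language has a word of
   length at most B(n).  As L(D') is closed under lengthening, L(D) is non-empty
   iff the single word 0^B(f(c1(D'))) is in L(D'), which is decidable. *)

From Stdlib Require Import Classical IndefiniteDescription.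
From mathcomp Require Import all_boot.
Require Import Defs.

Set Implicit Arguments.
Unset Strict Implicit.
Unset Printing Implicit Defensive.

(** * Mu-recursive functions on numbers *)

(** The list in [RComp] requires an inner fixpoint. For [RMin], the smaller of two distinct values
    would be both a zero of [g] and a point where [g] is positive. *)
Lemma rec_sem_inj p v y1 y2 : rec_sem p v y1 -> rec_sem p v y2 -> y1 = y2.
Proof.
move: p v y1 y2; fix IH 1; case=> [||i|g hs|g h|g] v y1 y2.
- by move=> /= -> ->.
- by move=> /= -> ->.
- by move=> /= -> ->.
- move=> /= [zs1 [H1 G1]] [zs2 [H2 G2]]; suff E : zs1 = zs2.
    by move: G1 G2; rewrite E; apply: IH.
  move: hs zs1 zs2 H1 H2 {G1 G2}; fix IHl 1.
  case=> [|h hs] [|z1 zs1] [|z2 zs2] //= [H1 H1'] [H2 H2'].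
  by rewrite (IH _ _ _ _ H1 H2) (IHl _ _ _ H1' H2').
- rewrite /=; elim: (head 0 v) y1 y2 => [|n IHn] y1 y2; first exact: IH.
  move=> [z1 [H1 G1]] [z2 [H2 G2]].
  by move: G1 G2; rewrite (IHn _ _ H1 H2); apply: IH.
- move=> /= [H1 L1] [H2 L2]; case: (ltngtP y1 y2) => // lt.
  + by have [z Hz] := L2 _ lt; have := IH _ _ _ _ Hz H1.
  + by have [z Hz] := L1 _ lt; have := IH _ _ _ _ Hz H2.
Qed.

Lemma rec_sem_comp1 g h v z y :
  rec_sem h v z -> rec_sem g [:: z] y -> rec_sem (RComp g [:: h]) v y.
Proof. by move=> Hh Hg; exists [:: z]. Qed.

Lemma rec_sem_comp2 g h1 h2 v z1 z2 y :
  rec_sem h1 v z1 -> rec_sem h2 v z2 -> rec_sem g [:: z1; z2] y ->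
  rec_sem (RComp g [:: h1; h2]) v y.
Proof. by move=> H1 H2 Hg; exists [:: z1; z2]. Qed.

Lemma rec_sem_prec g h (F : nat -> nat) n v :
  rec_sem g v (F 0) ->
  (forall i, i < n -> rec_sem h [:: i, F i & v] (F i.+1)) ->
  rec_sem (RPrec g h) (n :: v) (F n).
Proof.
move=> H0 HS /=; elim: n HS => // n IHn HS; exists (F n); split; last exact: HS.
by apply: IHn => i lt_in; apply/HS/ltnW.
Qed.

Lemma rec_sem_const n : exists p, forall v, rec_sem p v n.
Proof.
elim: n => [|n [p Hp]]; first by exists RZero.
by exists (RComp RSucc [:: p]) => v; apply: rec_sem_comp1 (Hp v) _.
Qed.

Definition rec_pred := RPrec RZero (RProj 0).

Lemma rec_sem_pred n : rec_sem rec_pred [:: n] n.-1.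
Proof. exact: (@rec_sem_prec _ _ predn). Qed.

Definition rec_add := RPrec (RProj 0) (RComp RSucc [:: RProj 1]).

Lemma rec_sem_add m n : rec_sem rec_add [:: m; n] (m + n).
Proof.
apply: (@rec_sem_prec _ _ (addn^~ n)) => // i _.
exact: rec_sem_comp1.
Qed.

(** [RPrec] recurses on its first argument, so the arguments are swapped to recurse on the
    subtrahend. *)
Definition rec_sub :=
  RComp (RPrec (RProj 0) (RComp rec_pred [:: RProj 1])) [:: RProj 1; RProj 0].

Lemma rec_sem_sub m n : rec_sem rec_sub [:: m; n] (m - n).
Proof.
apply: rec_sem_comp2 => //; apply: (@rec_sem_prec _ _ (subn m)) => [|i _].
  by rewrite /= subn0.
by rewrite subnS; apply: rec_sem_comp1 (rec_sem_pred _).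
Qed.

Definition rec_double := RComp rec_add [:: RProj 0; RProj 0].

Lemma rec_sem_double n : rec_sem rec_double [:: n] n.*2.
Proof. by rewrite -addnn; apply: rec_sem_comp2 (rec_sem_add _ _). Qed.

(** The recursion (i+1)/2 = i - i/2, with halves rounded down, avoids a case distinction on
    parity. *)
Definition rec_half := RPrec RZero (RComp rec_sub [:: RProj 0; RProj 1]).

Lemma rec_sem_half n : rec_sem rec_half [:: n] n./2.
Proof.
apply: (@rec_sem_prec _ _ half) => // i _.
have -> : i.+1./2 = i - i./2.
  by rewrite -[i in i - _]odd_double_half -addnn addnA addnK /= uphalf_half.
exact: rec_sem_comp2 (rec_sem_sub _ _).
Qed.

(* The arguments [n] and [CodeSeq.code s] give [CodeSeq.code (n :: s)]. *)
Definition rec_cons :=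
  RPrec (RComp RSucc [:: rec_double]) (RComp rec_double [:: RProj 1]).

Lemma rec_sem_cons n m : rec_sem rec_cons [:: n; m] (2 ^ n * m.*2.+1).
Proof.
apply: (@rec_sem_prec _ _ (fun n => 2 ^ n * m.*2.+1)) => [|i _].
  by rewrite mul1n; apply: rec_sem_comp1 (rec_sem_double _) _.
by rewrite expnS -mulnA mul2n; apply: rec_sem_comp1 (rec_sem_double _).
Qed.

Definition rec_iter_half := RPrec (RProj 0) (RComp rec_half [:: RProj 1]).

Lemma rec_sem_iter_half n m :
  rec_sem rec_iter_half [:: n; m] (iter n half m).
Proof.
apply: (@rec_sem_prec _ _ (fun n => iter n half m)) => // i _.
exact: rec_sem_comp1 (rec_sem_half _).
Qed.

Lemma iter_half_code i n m :
  i <= n -> iter i half (2 ^ n * m.*2.+1) = 2 ^ (n - i) * m.*2.+1.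
Proof.
elim: i => [|i IHi] lt_in; first by rewrite subn0.
by rewrite iterS (IHi (ltnW lt_in)) -subnSK // expnS -mulnA mul2n doubleK.
Qed.

(** With the half rounded down, 2(n/2) + 1 - n is 1 for even n and 0 for odd n. *)
Definition rec_even :=
  RComp rec_sub [:: RComp RSucc [:: RComp rec_double [:: rec_half]]; RProj 0].

Lemma rec_sem_even n : rec_sem rec_even [:: n] (~~ odd n).
Proof.
have -> : (~~ odd n : nat) = n./2.*2.+1 - n.
  by rewrite -[n in _ - n]odd_double_half -add1n subnDr; case: odd.
apply: rec_sem_comp2 (rec_sem_sub _ _) => //.
apply: rec_sem_comp1 => //.
exact: rec_sem_comp1 (rec_sem_half n) (rec_sem_double _).
Qed.

(** In a code 2^n (2m+1) the head n is the least number of halvings that leads to an odd number,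
    where [rec_even] vanishes. *)
Definition rec_head := RMin (RComp rec_even [:: rec_iter_half]).

Lemma rec_sem_head n m : rec_sem rec_head [:: 2 ^ n * m.*2.+1] n.
Proof.
have E i : i <= n ->
    rec_sem (RComp rec_even [:: rec_iter_half]) [:: i; 2 ^ n * m.*2.+1]
      (~~ odd (2 ^ (n - i) * m.*2.+1)).
  move=> le_in; rewrite -iter_half_code //.
  apply: rec_sem_comp1 (rec_sem_iter_half _ _) _; exact: rec_sem_even.
split=> [|i lt_in].
  by have := E n (leqnn n); rewrite subnn mul1n /= odd_double.
by exists 0; have := E i (ltnW lt_in); rewrite oddM oddX subn_eq0 leqNgt lt_in.
Qed.

(** Removing the factor 2^n leaves 2m+1, and one more halving drops the final 1. *)
Definition rec_tail :=
  RComp rec_half [:: RComp rec_iter_half [:: rec_head; RProj 0]].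

Lemma rec_sem_tail n m : rec_sem rec_tail [:: 2 ^ n * m.*2.+1] m.
Proof.
have Em : m = (iter n half (2 ^ n * m.*2.+1))./2.
  by rewrite iter_half_code // subnn mul1n /= uphalf_double.
rewrite [X in rec_sem _ _ X]Em; apply: rec_sem_comp1 (rec_sem_half _).
by apply: rec_sem_comp2 (rec_sem_iter_half _ _) => //; apply: rec_sem_head.
Qed.

(** * Computable functions between countable types *)

(** Values outside [D] are arbitrary, so [f] may be obtained by choice from an effective
    procedure. *)
Definition computable (T U : countType) (D : T -> Prop) (f : T -> U) : Prop :=
  exists p, forall x, D x -> rec_sem p [:: pickle x] (pickle (f x)).

Section Computable.

Variables (T : countType) (D : T -> Prop).

Lemma computable_ext (U : countType) (f g : T -> U) :
  (forall x, D x -> f x = g x) -> computable D f -> computable D g.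
Proof. by move=> fg [p Hp]; exists p => x Dx; rewrite -fg //; apply: Hp. Qed.

Lemma computable_weaken (U : countType) (E : T -> Prop) (f : T -> U) :
  (forall x, D x -> E x) -> computable E f -> computable D f.
Proof. by move=> DE [p Hp]; exists p => x /DE; apply: Hp. Qed.

Lemma computable_id : computable D id.
Proof. by exists (RProj 0). Qed.

Lemma computable_const (U : countType) (c : U) : computable D (fun _ => c).
Proof. by have [p Hp] := rec_sem_const (pickle c); exists p. Qed.

Lemma computable_comp (U V : countType) (E : U -> Prop) (g : U -> V)
    (f : T -> U) :
  computable E g -> computable D f -> (forall x, D x -> E (f x)) ->
  computable D (fun x => g (f x)).
Proof.
move=> [q Hq] [p Hp] DE; exists (RComp q [:: p]) => x Dx.
exact: rec_sem_comp1 (Hp _ Dx) (Hq _ (DE _ Dx)).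
Qed.

(** A pair is pickled as the code of the two-element list of the pickles of its components; [RZero]
    supplies the code of the empty list. *)
Lemma computable_pair (U V : countType) (f : T -> U) (g : T -> V) :
  computable D f -> computable D g -> computable D (fun x => (f x, g x)).
Proof.
move=> [p Hp] [q Hq].
exists (RComp rec_cons [:: p; RComp rec_cons [:: q; RZero]]) => x Dx.
apply: rec_sem_comp2 (Hp _ Dx) _ (rec_sem_cons _ _).
exact: rec_sem_comp2 (Hq _ Dx) _ (rec_sem_cons _ _).
Qed.

Lemma computable_fst (U V : countType) (f : T -> U * V) :
  computable D f -> computable D (fun x => (f x).1).
Proof.
move=> [p Hp]; exists (RComp rec_head [:: p]) => x /Hp Hx.
by apply: rec_sem_comp1 Hx _; case: (f x) => u v; apply: rec_sem_head.
Qed.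

Lemma computable_snd (U V : countType) (f : T -> U * V) :
  computable D f -> computable D (fun x => (f x).2).
Proof.
move=> [p Hp].
exists (RComp rec_head [:: RComp rec_tail [:: p]]) => x /Hp Hx.
case: (f x) Hx => u v Hx.
exact: rec_sem_comp1 (rec_sem_comp1 Hx (rec_sem_tail _ _)) (rec_sem_head _ _).
Qed.

Lemma computable_cons (U : countType) (f : T -> U) (s : T -> seq U) :
  computable D f -> computable D s -> computable D (fun x => f x :: s x).
Proof.
move=> [p Hp] [q Hq]; exists (RComp rec_cons [:: p; q]) => x Dx.
exact: rec_sem_comp2 (Hp _ Dx) (Hq _ Dx) (rec_sem_cons _ _).
Qed.

(** The empty sequence has code 0, which no number of halvings makes odd, so [rec_tail] diverges on
    it. *)
Lemma computable_behead (U : countType) (s : T -> seq U) :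
  (forall x, D x -> s x != [::]) ->
  computable D s -> computable D (fun x => behead (s x)).
Proof.
move=> s0 [p Hp]; exists (RComp rec_tail [:: p]) => x Dx.
apply: rec_sem_comp1 (Hp _ Dx) _.
case: (s x) (s0 _ Dx) => // u t _.
exact: (rec_sem_tail (pickle u) (pickle t)).
Qed.

Lemma computable_succ (f : T -> nat) :
  computable D f -> computable D (fun x => (f x).+1).
Proof.
move=> [p Hp]; exists (RComp RSucc [:: p]) => x Dx.
exact: rec_sem_comp1 (Hp _ Dx) _.
Qed.

Lemma computable_add (f g : T -> nat) :
  computable D f -> computable D g -> computable D (fun x => f x + g x).
Proof.
move=> [p Hp] [q Hq]; exists (RComp rec_add [:: p; q]) => x Dx.
exact: rec_sem_comp2 (Hp _ Dx) (Hq _ Dx) (rec_sem_add _ _).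
Qed.

Lemma computable_sub (f g : T -> nat) :
  computable D f -> computable D g -> computable D (fun x => f x - g x).
Proof.
move=> [p Hp] [q Hq]; exists (RComp rec_sub [:: p; q]) => x Dx.
exact: rec_sem_comp2 (Hp _ Dx) (Hq _ Dx) (rec_sem_sub _ _).
Qed.

Lemma computable_negb (b : T -> bool) :
  computable D b -> computable D (fun x => ~~ b x).
Proof.
(* The pickle of a boolean is convertible to 0 or 1, so negation is subtraction from 1. *)
move=> cb; have [p Hp] := computable_sub (computable_const 1)
  (cb : computable D (nat_of_bool \o b)).
by exists p => x /Hp; rewrite /=; case: (b x).
Qed.

Lemma computable_iter (U : countType) (E : U -> Prop) (k : T -> nat)
    (g : T -> U) (h : U -> U) :
  computable D k -> computable D g -> computable E h ->
  (forall x n, D x -> n < k x -> E (iter n h (g x))) ->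
  computable D (fun x => iter (k x) h (g x)).
Proof.
move=> [pk Hk] [pg Hg] [ph Hh] DE.
exists (RComp (RPrec pg (RComp ph [:: RProj 1])) [:: pk; RProj 0]) => x Dx.
apply: rec_sem_comp2 (Hk _ Dx) _ _; first by [].
apply: (@rec_sem_prec _ _ (fun n => pickle (iter n h (g x)))) => [|i lt_ik].
  exact: Hg.
by apply: rec_sem_comp1; last exact/Hh/DE.
Qed.

Lemma computable_min (E : nat * T -> Prop) (g : nat * T -> nat) (m : T -> nat) :
  computable E g ->
  (forall x i, D x -> i <= m x -> E (i, x)) ->
  (forall x, D x -> g (m x, x) = 0) ->
  (forall x i, D x -> i < m x -> 0 < g (i, x)) ->
  computable D m.
Proof.
move=> [p Hp] DE g0 gS.
(* [RMin] supplies [i] and the pickle of [x] as separate arguments; the nested [rec_cons] builds the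
   pickle of the pair. *)
exists (RMin (RComp p [:: RComp rec_cons
  [:: RProj 0; RComp rec_cons [:: RProj 1; RZero]]])) => x Dx.
have G i : i <= m x -> rec_sem (RComp p [:: RComp rec_cons
    [:: RProj 0; RComp rec_cons [:: RProj 1; RZero]]]) [:: i; pickle x]
    (g (i, x)).
  move=> le_im; apply: rec_sem_comp1 (Hp _ (DE _ _ Dx le_im)).
  apply: rec_sem_comp2 (rec_sem_cons _ _); first by [].
  exact: rec_sem_comp2 (rec_sem_cons _ _).
split=> [|i lt_im]; first by have := G _ (leqnn _); rewrite g0.
by exists (g (i, x)).-1; rewrite prednK ?gS //; apply/G/ltnW.
Qed.

End Computable.

Lemma computable_nseq (T U : countType) (D : T -> Prop) (c : U)
    (n : T -> nat) : computable D n -> computable D (fun x => nseq (n x) c).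
Proof.
move=> cn.
apply: (@computable_iter _ _ _ (fun _ => True) n (fun _ => [::])) => //.
  exact: computable_const.
by apply: computable_cons; [apply: computable_const | apply: computable_id].
Qed.

Lemma size_iter_behead (T : Type) n (s : seq T) :
  size (iter n behead s) = size s - n.
Proof. by elim: n => [|n IHn]; rewrite ?subn0 //= size_behead IHn subnS. Qed.

(** The size is found by search, as the least number of applications of [behead] that leads to code
    0. The domain [E] ensures that [behead] never meets an empty sequence. *)
Lemma computable_size (T U : countType) (D : T -> Prop) (s : T -> seq U) :
  computable D s -> computable D (fun x => size (s x)).
Proof.
move=> cs; pose E (y : nat * T) := D y.2 /\ y.1 <= size (s y.2).
have cE : computable E (fun y => iter y.1 behead (s y.2)).
  apply: (@computable_iter _ _ _ (fun t => t != [::])).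
  - exact/computable_fst/computable_id.
  - apply: (computable_comp cs); first exact/computable_snd/computable_id.
    by move=> y [].
  - by apply: computable_behead => //; apply: computable_id.
  - move=> [i x] n [_ /= le_is] lt_ni; rewrite -size_eq0 size_iter_behead.
    by rewrite subn_eq0 -ltnNge; apply: leq_trans le_is.
pose g (y : nat * T) := pickle (iter y.1 behead (s y.2)).
apply: (@computable_min _ _ E g) => //.
- move=> x Dx; rewrite /g /=; have := size_iter_behead (size (s x)) (s x).
  by rewrite subnn => /size0nil ->.
- move=> x i Dx lt_is; rewrite /g /=; have := size_iter_behead i (s x).
  case: (iter i behead (s x)) => [/esym/eqP|u t _].
    by rewrite /= subn_eq0 leqNgt lt_is.
  by rewrite /pickle /= muln_gt0 expn_gt0.
Qed.

(** * Functions extracted from effective procedures *)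

(** Choice selects for each input in [D] an output of the procedure, and [u0] elsewhere; the
    procedure itself then computes the selected function on [D]. *)
Lemma effectiveP (T U : countType) (D : T -> Prop) (spec : T -> U -> Prop) :
  inhabited U -> effective D spec ->
  exists f, computable D f /\ forall x, D x -> spec x (f x).
Proof.
move=> [u0] [p Hp].
have [x|f Hf] := @functional_choice T U (fun x y =>
    D x -> rec_sem p [:: pickle x] (pickle y) /\ spec x y).
  case: (classic (D x)) => [/Hp [y Hy]|nDx]; first by exists y.
  by exists u0.
by exists f; split=> [|x /Hf []//]; exists p => x /Hf [].
Qed.

Lemma decidable_onP (T : countType) (D P : T -> Prop) :
  decidable_on D P <->
  exists b : T -> bool, computable D b /\ forall x, D x -> (b x <-> P x).
Proof.
split=> [[p Hp]|[b [[p Hp] bP]]]; last first.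
  by exists p => x Dx; exists (b x); split; [apply: Hp | apply: bP].
by apply: (@effectiveP _ bool _ (fun x (y : bool) => y <-> P x));
  [exact: (inhabits true) | exists p].
Qed.

(* Where [c] is bounded on [P], only finitely many values of [g] matter;
   otherwise the enumeration reaches elements of size greater than [n], and it
   suffices to sum [g] over the elements enumerated before the first one. *)
Lemma computable_bound (P : word -> Prop) (c g : word -> nat) :
  re_by_size P c ->
  (forall n, exists s : seq word, forall D, P D -> c D = n -> D \in s) ->
  computable P c -> computable P g ->
  exists B : nat -> nat, computable (fun _ => True) B /\
    forall n D, P D -> c D <= n -> g D <= B n.
Proof.
move=> [p [pP Pp p_init p_mono]] finP cc cg.
case: (classic (exists n, forall D, P D -> c D <= n)) => [[N cN]|unb].
  have [s sP] : exists s : seq word, forall D, P D -> c D < N.+1 -> D \in s.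
    elim: N.+1 => [|n [s sP]]; first by exists [::].
    have [t tP] := finP n; exists (s ++ t) => D PD.
    rewrite ltnS leq_eqVlt mem_cat => /orP[/eqP/(tP _ PD) ->|/(sP _ PD) -> //].
    by rewrite orbT.
  exists (fun _ => \max_(D <- s) g D); split; first exact: computable_const.
  by move=> _ D PD _; apply: leq_bigmax_seq => //; apply: sP => //; apply: cN.
pose H i := exists D : word, rec_sem p [:: i] (pickle D).
have [e eP] : exists e : nat -> word, forall i, H i ->
    rec_sem p [:: i] (pickle (e i)).
  apply: functional_choice
    (fun i D => H i -> rec_sem p [:: i] (pickle D)) _ => i.
  by case: (classic (H i)) => [[D HD]|nH]; [exists D | exists [::]].
have H_le i j : i <= j -> H j -> H i.
  move=> le_ij [D HD]; have [z Hz] := p_init _ _ _ le_ij HD.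
  by have [E _ Ez] := pP _ _ Hz; exists E; rewrite -Ez.
have eH i : H i -> P (e i).
  by move=> /eP /pP [D PD] /(pcan_inj pickleK) ->.
have e_surj D : P D -> exists2 i, H i & e i = D.
  move=> /Pp [i Hi]; have Hi' : H i by exists D.
  exists i => //; apply: (pcan_inj pickleK).
  exact: rec_sem_inj (eP _ Hi') Hi.
have ce : computable H e by exists p.
(* [m n] is the index of the first enumerated element of size greater than [n]; it exists because
   [c] is unbounded on [P]. *)
have [m mP] : exists m : nat -> nat, forall n,
    [/\ H (m n), n < c (e (m n)) & forall i, i < m n -> c (e i) <= n].
  apply: functional_choice (fun n i =>
    [/\ H i, n < c (e i) & forall j, j < i -> c (e j) <= n]) _ => n.
  have [i [Hi lt_ni]] : exists i, H i /\ n < c (e i).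
    apply: NNPP => none; apply: unb; exists n => D /e_surj [i Hi <-].
    by rewrite leqNgt; apply/negP => lt_n; apply: none; exists i.
  elim/ltn_ind: i Hi lt_ni => i IHi Hi lt_ni.
  case: (classic (exists2 j, j < i & n < c (e j))) => [[j lt_ji lt_nj]|no].
    by apply: (IHi j) => //; apply: H_le (ltnW lt_ji) Hi.
  exists i; split=> // j lt_ji; rewrite leqNgt; apply/negP => lt_nj.
  by apply: no; exists j.
have Hm n i : i <= m n -> H i by move=> le_im; have [/(H_le _ _ le_im)] := mP n.
have cm : computable (fun _ => True) m.
  pose E (y : nat * nat) := H y.1.
  have c1 : computable E fst by apply/computable_fst/computable_id.
  have c2 : computable E snd by apply/computable_snd/computable_id.
  apply: (@computable_min _ _ E (fun y => y.2.+1 - c (e y.1))).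
  - apply: computable_sub; first exact: computable_succ.
    apply: (computable_comp cc); last by move=> y /eH.
    exact: (computable_comp ce).
  - by move=> n i _ /Hm.
  - by move=> n _ /=; have [_ lt_n _] := mP n; apply/eqP; rewrite subn_eq0.
  - by move=> n i _ lt_im; have [_ _ /(_ _ lt_im)] := mP n; rewrite subn_gt0.
(* The state holds the next index and the sum of [g] over the elements already passed. *)
pose step (y : nat * nat) := (y.1.+1, y.2 + g (e y.1)).
pose sums n := iter n step (0, 0).
have sums1 n : (sums n).1 = n by elim: n => //= n ->.
have sums2 n i : i < n -> g (e i) <= (sums n).2.
  elim: n => // n IHn; rewrite ltnS leq_eqVlt => /orP[/eqP ->|/IHn le_in] /=.
    by rewrite sums1 leq_addl.
  exact: leq_trans le_in (leq_addr _ _).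
exists (fun n => (sums (m n)).2); split.
  apply: computable_snd; apply: (@computable_iter _ _ _ (H \o fst)) => //.
  - exact: computable_const.
  - apply: computable_pair.
      exact/computable_succ/computable_fst/computable_id.
    apply: computable_add; first exact/computable_snd/computable_id.
    apply: (computable_comp cg); last by move=> y /eH.
    by apply: (computable_comp ce) => //; apply/computable_fst/computable_id.
  - by move=> n i _ /ltnW le_im; rewrite /= -/(sums i) sums1; apply: Hm le_im.
move=> n D /e_surj [i Hi <-] le_cn; apply: sums2.
(* From index [m n] on, all sizes exceed [n], as the enumeration is by increasing size. *)
rewrite ltnNge; apply/negP => le_mi; have [Hmn lt_n _] := mP n.
have := p_mono _ _ _ _ le_mi (eP _ Hmn) (eP _ Hi).
by rewrite leqNgt (leq_ltn_trans le_cn lt_n).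
Qed.

(** * Effective trios *)

Lemma over1P a w : reflect (w = nseq (size w) a) (over [:: a] w).
Proof.
rewrite /over (eq_all (a2 := pred1 a)); last by move=> b; rewrite /= inE.
exact: all_pred1P.
Qed.

Lemma over1_nseq a n : over [:: a] (nseq n a).
Proof. by apply/over1P; rewrite size_nseq. Qed.

Lemma foldl_obind_none (T A : Type) (f : T -> A -> option T) (s : seq A) :
  foldl (fun ox a => obind (f^~ a) ox) None s = None.
Proof. by elim: s. Qed.

Lemma mor_apply_nseq A B a w :
  over A w -> mor_apply (Mor A B (nseq (size A) [:: a])) w = nseq (size w) a.
Proof.
elim: w => //= b w IHw /andP[/= bA /IHw <-].
by rewrite /mor_apply /= nth_nseq index_mem bA.
Qed.

Lemma effective_mor_morphism (S : desc_system) (h : mor) :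
  eff_closed_lambda_free_mor S -> wf_mor h -> lambda_free h ->
  exists F : word -> word, computable (desc_over S (mor_dom h)) F /\
    forall D, desc_over S (mor_dom h) D ->
      describes S (image_language h (ds_lang S D)) (F D).
Proof.
move=> /(effectiveP (inhabits [::])) [F [cF FP]] wf_h free_h.
exists (fun D => F (D, h)); split=> [|D [SD alphD]]; last exact: (FP (D, h)).
apply: (computable_comp cF) => [|D [SD alphD] //].
by apply: computable_pair; [apply: computable_id | apply: computable_const].
Qed.

Lemma effective_inverse_morphism (S : desc_system) (h : mor) :
  eff_closed_inverse_mor S -> wf_mor h ->
  exists F : word -> word, computable (desc_over S (mor_cod h)) F /\
    forall D, desc_over S (mor_cod h) D ->
      describes S (preimage_language h (ds_lang S D)) (F D).
Proof.
move=> /(effectiveP (inhabits [::])) [F [cF FP]] wf_h.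
exists (fun D => F (D, h)); split=> [|D [SD alphD]]; last exact: (FP (D, h)).
apply: (computable_comp cF) => [|D [SD alphD] //].
by apply: computable_pair; [apply: computable_id | apply: computable_const].
Qed.

Lemma describes_over S L D : describes S L D -> desc_over S (alph L) D.
Proof. by case=> SD [alphD _]. Qed.

(** The semi-deciding machine constructed from a descriptor carries the alphabet as the first
    component of its tuple. *)
Lemma computable_alph (S : desc_system) :
  computable (ds_mem S) (fun D => alph (ds_lang S D)).
Proof.
have [M [cM MP]] :=
  effectiveP (inhabits (TM [::] 0 [::] [::])) (@ds_semidecider S).
apply: (@computable_ext _ _ _ (fun D => (tm_tuple (M D)).1)).
  by move=> D /MP [].
by apply: computable_fst; apply: cM.
Qed.

(* [w] belongs to L iff the inverse image of L under the morphism sending the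
   single letter [0] to [w] meets {0}. *)
Lemma trio_decidable_word_problem (S : desc_system) A :
  effective_trio S -> decidable_emptiness S -> is_alphabet A ->
  decidable_on (fun x : word * word => desc_over S A x.1 /\ over A x.2)
    (fun x => ds_lang S x.1 x.2).
Proof.
move=> [_ /(effectiveP (inhabits [::])) [F [cF FP]]
  /(effectiveP (inhabits [::])) [I [cI IP]] _] /decidable_onP [b [cb bP]] alphA.
pose h w := Mor [:: 0] A [:: w].
(* State 1 has no outgoing transition, so among the words over {0} only [[:: 0]] is accepted. *)
pose M := DFA 0 [:: 1] [:: ((0, 0), 1)].
have Mword w : over [:: 0] w -> dfa_accepts M w -> w = [:: 0].
  move=> /over1P ->; case: (size w) => [|[|n]] //.
  by rewrite /dfa_accepts /dfa_run /= foldl_obind_none.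
set dom := fun x : word * word => _.
have wf_h x : dom x -> wf_mor (h x.2).
  by case=> _ over_x; rewrite /wf_mor alphA /= over_x.
have Fdom x : dom x -> [/\ ds_mem S x.1, wf_mor (h x.2)
    & alph (ds_lang S x.1) = mor_cod (h x.2)].
  by move=> dx; split; [case: dx => [[]] | apply: wf_h | case: dx => [[]]].
pose G (x : word * word) := I (F (x.1, h x.2), M).
have GP x : dom x ->
    describes S (inter_regular (ds_lang S (F (x.1, h x.2))) M) (G x).
  by move=> /Fdom dx; have [SF _] := FP (x.1, h x.2) dx; apply: (IP (_, M)).
apply/decidable_onP; exists (fun x => ~~ b (G x)); split.
  apply: computable_negb; apply: (computable_comp cb); last by move=> x /GP [].
  apply: (computable_comp cI).
    apply: computable_pair; last exact: computable_const.
    apply: (computable_comp cF); last exact: Fdom.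
    apply: computable_pair; first exact/computable_fst/computable_id.
    (* A record is pickled as its tuple, so the morphism can be assembled by pairing. *)
    apply: (_ : computable dom (fun x => mor_tuple (h x.2))).
    apply: computable_pair; first exact: computable_const.
    apply: computable_pair; first exact: computable_const.
    apply: computable_cons; last exact: computable_const.
    exact/computable_snd/computable_id.
  by move=> x /Fdom /(FP (x.1, h x.2)) [].
move=> x dx; have [SG [_ GE]] := GP x dx.
have [SF [_ FE]] := FP (x.1, h x.2) (Fdom x dx).
have app0 : mor_apply (h x.2) [:: 0] = x.2 by rewrite /mor_apply /= cats0.
split=> [nb|Lx].
  apply: NNPP => nLx; case/negP: nb; apply/(bP _ SG).
  move=> w /GE [/FE [/= w0 Lw] Mw].
  by move: Lw; rewrite (Mword w) // app0.
apply/negP => /(bP _ SG) /(_ [:: 0]); apply; apply/GE; split=> //.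
by apply/FE; split=> //; rewrite app0.
Qed.

(** The length of a shortest word is computable: decide emptiness first, then search with the word
    problem. [computable_bound] turns it into a bound in terms of the size. *)
Lemma computable_min_length_bound (S : desc_system) (c : word -> nat) :
  complexity_measure S c -> effective_trio S -> decidable_emptiness S ->
  exists B : nat -> nat, computable (fun _ => True) B /\
    forall n D m, desc_over S [:: 0] D -> c D <= n ->
      ds_lang S D (nseq m 0) ->
      exists2 k, k <= B n & ds_lang S D (nseq k 0).
Proof.
move=> [/(effectiveP (inhabits 0)) [c' [cc' c'P]] cP] trioS emptS.
have [re_c finc] := cP [:: 0] isT.
have /decidable_onP [w [cw wP]] :=
  trio_decidable_word_problem trioS emptS (isT : is_alphabet [:: 0]).
have /decidable_onP [e [ce eP]] := emptS.
have P_mem D : desc_over S [:: 0] D -> ds_mem S D by case.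
have cc : computable (desc_over S [:: 0]) c.
  by apply: computable_ext (computable_weaken P_mem cc') => D /P_mem /c'P.
(* [g D] is the shortest length, or 0 if D describes the empty language. *)
have [g gP] : exists g : word -> nat, forall D, desc_over S [:: 0] D ->
    (e D || w (D, nseq (g D) 0)) /\
    forall i, i < g D -> ~~ e D && ~~ w (D, nseq i 0).
  apply: functional_choice (fun D n => desc_over S [:: 0] D ->
    (e D || w (D, nseq n 0)) /\
    forall i, i < n -> ~~ e D && ~~ w (D, nseq i 0)) _ => D.
  case: (classic (desc_over S [:: 0] D)) => [PD|]; last by exists 0.
  have [n nP] : exists n, e D || w (D, nseq n 0).
    case De: (e D); first by exists 0.
    apply: NNPP => none; case/negP: De; apply/(eP _ (P_mem _ PD)) => u Lu.
    have [SD alphD] := PD; have [_ /(_ _ Lu)] := ds_wf SD.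
    rewrite alphD => /over1P Eu; apply: none; exists (size u).
    apply/(wP (D, nseq (size u) 0)); rewrite -Eu //.
    by split=> //; apply/over1P.
  have [k kP k_min] :=
    ex_minnP (ex_intro (fun n => e D || w (D, nseq n 0)) n nP).
  exists k => _; split=> // i lt_ik; rewrite -negb_or; apply/negP => /k_min.
  by rewrite leqNgt lt_ik.
have cg : computable (desc_over S [:: 0]) g.
  pose E (y : nat * word) := desc_over S [:: 0] y.2.
  (* The truncated difference is 0 exactly when [w] accepts or [e] reports emptiness, so the search
     also stops on empty languages. *)
  apply: (@computable_min _ _ E (fun y => (~~ w (y.2, nseq y.1 0)) - e y.2)).
  - apply: computable_sub.
      suff : computable E (fun y => ~~ w (y.2, nseq y.1 0)) by [].
      apply: computable_negb; apply: (computable_comp cw).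
        apply: computable_pair; first exact/computable_snd/computable_id.
        exact/computable_nseq/computable_fst/computable_id.
      by move=> [i D] PD; split=> //; apply: over1_nseq.
    suff : computable E (fun y => e y.2) by [].
    apply: (computable_comp ce); first exact/computable_snd/computable_id.
    by move=> y [].
  - by [].
  - by move=> D /gP [/= /orP[]->]; case: (w _) => //; case: (e _).
  - by move=> D i /gP [_ H] /H /andP[/= /negbTE -> ->].
have [B [cB BP]] := computable_bound re_c finc cc cg.
exists B; split=> // n D m PD le_cn Lm; exists (g D); first exact: BP.
have [/orP eg _] := gP D PD; case: eg => [/(eP _ (P_mem _ PD)) /(_ _ Lm) //|wg].
 apply/(wP (D, nseq (g D) 0)) => //.
by split=> //; apply: over1_nseq.
Qed.

(** The morphisms [h1] and [h3] send letters to letters and hence are [lambda_free] and preserve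
    length. Only [h2] erases, and it is applied inversely. *)
Lemma computable_upward_closure (S : desc_system) :
  effective_trio S ->
  exists F : word -> word, computable (ds_mem S) F /\
    forall D, ds_mem S D ->
      [/\ desc_over S [:: 0] (F D),
          forall m, ds_lang S (F D) (nseq m 0) ->
            ds_lang S (F D) (nseq m.+1 0)
        & (exists m, ds_lang S (F D) (nseq m 0)) <->
          (exists w, ds_lang S D w)].
Proof.
move=> [morS invS _ _].
pose h1 D := Mor (alph (ds_lang S D)) [:: 0]
  (nseq (size (alph (ds_lang S D))) [:: 0]).
(* The inverse of [h2] inserts the letter 1 anywhere. *)
pose h2 := Mor [:: 0; 1] [:: 0] [:: [:: 0]; [::]].
pose h3 := Mor [:: 0; 1] [:: 0] (nseq 2 [:: 0]).
have [G [cG GP]] := @effective_inverse_morphism S h2 invS isT.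
have [H [cH HP]] := @effective_mor_morphism S h3 morS isT isT.
have [F1 [cF1 F1P]] := effectiveP (inhabits [::]) morS.
have F1dom D : ds_mem S D -> [/\ ds_mem S D, wf_mor (h1 D),
    lambda_free (h1 D) & alph (ds_lang S D) = mor_dom (h1 D)].
  move=> SD; have [alphD _] := ds_wf SD; split=> //.
    by rewrite /wf_mor alphD /= size_nseq eqxx all_nseq orbT.
  by rewrite /lambda_free all_nseq orbT.
pose D1 D := F1 (D, h1 D).
have D1P D : ds_mem S D ->
    describes S (image_language (h1 D) (ds_lang S D)) (D1 D).
  by move=> /F1dom; apply: (F1P (_, _)).
have GD1 D : ds_mem S D ->
    describes S (preimage_language h2 (ds_lang S (D1 D))) (G (D1 D)).
  by move=> /D1P /describes_over; apply: GP.
have HD1 D : ds_mem S D ->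
    describes S (image_language h3 (ds_lang S (G (D1 D)))) (H (G (D1 D))).
  by move=> /GD1 /describes_over; apply: HP.
exists (fun D => H (G (D1 D))); split.
  apply: (computable_comp cH); last by move=> D /GD1 /describes_over.
  apply: (computable_comp cG); last by move=> D /D1P /describes_over.
  apply: (computable_comp cF1); last exact: F1dom.
  apply: computable_pair; first exact: computable_id.
  have cA := computable_alph S.
  apply: (_ : computable (ds_mem S) (fun D => mor_tuple (h1 D))).
  apply: computable_pair => //; apply: computable_pair.
    exact: computable_const.
  exact/computable_nseq/computable_size.
move=> D SD; have [_ wfD] := ds_wf SD.
have [_ [_ E1]] := D1P D SD; have [_ [_ E2]] := GD1 D SD.
have [_ [_ E3]] := HD1 D SD.
have mem m : ds_lang S (H (G (D1 D))) (nseq m 0) <->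
    exists w, [/\ over [:: 0; 1] w, size w = m
                & ds_lang S (D1 D) (mor_apply h2 w)].
  split=> [/E3 /= [w /E2 [/= ow Lw]]|[w [ow <- Lw]]].
    rewrite (mor_apply_nseq (A := [:: 0; 1])) // => /(congr1 size).
    by rewrite !size_nseq => ->; exists w.
  apply/E3; exists w; first exact/E2.
  by rewrite (mor_apply_nseq (A := [:: 0; 1])).
split; first exact: describes_over (HD1 D SD).
  (* A further letter 1 lengthens the word without changing its image under [h2]. *)
  move=> m /mem [w [ow <- Lw]]; apply/mem; exists (1 :: w); split=> //.
split=> [[m /mem [w [_ _ /E1 [u Lu _]]]]|[u Lu]]; first by exists u.
exists (size u); apply/mem; exists (nseq (size u) 0); split.
- by rewrite /over all_nseq orbT.
- by rewrite size_nseq.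
apply/E1; exists u => //; rewrite mor_apply_nseq; last exact: wfD.
by elim: (size u) => //= n IHn; rewrite -[in RHS]IHn.
Qed.

(** Take a word [w] of some language of the family. As [h] maps 1 to [w] and erases 0, the preimage
    contains 1 0^n for all n. Intersecting with the language 1 0* of [M] leaves exactly 1 0*, which
    [h'] maps onto 0^k 0*. For k > 0 the morphism [h'] is [lambda_free]. *)
Lemma trio_in_family_unary_tail (S : desc_system) k :
  effective_trio S -> 0 < k ->
  in_family S (Language [:: 0] (fun w => w = nseq (size w) 0 /\ k <= size w)).
Proof.
move=> [morS invS interS [D [w [SD Lw]]]] k_gt0.
have [I [_ IP]] := effectiveP (inhabits [::]) interS.
have [alphD /(_ _ Lw) ow] := ds_wf SD.
pose A := alph (ds_lang S D).
pose h := Mor [:: 0; 1] A [:: [::]; w].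
pose M := DFA 0 [:: 1] [:: ((0, 1), 1); ((1, 0), 1)].
pose h' := Mor [:: 0; 1] [:: 0] [:: [:: 0]; nseq k 0].
have wf_h : wf_mor h by rewrite /wf_mor alphD /= ow.
have wf_h' : wf_mor h' by rewrite /wf_mor /= over1_nseq.
have free_h' : lambda_free h' by rewrite /lambda_free /=; case: (k) k_gt0.
have [G [_ /(_ D (conj SD erefl)) GD]] := effective_inverse_morphism invS wf_h.
have {IP} ID := IP (G D, M) (proj1 GD); move: (I _) ID => D' /= ID.
have [H [_ /(_ D') HD]] := effective_mor_morphism morS wf_h' free_h'.
have {HD} [SH [alphH HE]] :
    describes S (image_language h' (ds_lang S D')) (H D').
  apply: HD; have [SD' [alphD' _]] := ID; split=> //.
  by rewrite alphD'; case: GD => _ [].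
have [_ [_ GE]] := GD; have [_ [_ IE]] := ID.
have h'0 n : mor_apply h' (1 :: nseq n 0) = nseq (k + n) 0.
  rewrite nseqD; congr (_ ++ _).
  by elim: n => //= n IHn; rewrite -[in RHS]IHn.
have run0 n : dfa_accepts M (1 :: nseq n 0).
  by rewrite /dfa_accepts /dfa_run /=; elim: n.
have Mword u : over [:: 0; 1] u -> dfa_accepts M u ->
    exists n, u = 1 :: nseq n 0.
  case: u => [|[|[|a]] u] //=; rewrite /dfa_accepts /dfa_run /=.
    by rewrite foldl_obind_none.
  move=> ou; rewrite [lookup _ _]/= => Mu; exists (size u).
  congr (_ :: _); elim: u ou Mu => [|[|[|a]] u IHu] //= ou; last first.
    by rewrite foldl_obind_none.
  by move/(IHu ou) => {1}->.
exists (H D'); split=> //; split=> // v; split.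
  move=> /HE [u /IE [/GE [ou _] Mu] ->].
  have [n ->] := Mword u ou Mu.
  by rewrite h'0; split; rewrite size_nseq ?leq_addr.
move=> [Ev le_kv]; apply/HE; exists (1 :: nseq (size v - k) 0).
  apply/IE; split; last exact: run0; apply/GE; split.
    by rewrite /over /= all_nseq orbT.
  have -> : mor_apply h (1 :: nseq (size v - k) 0) = w; last by [].
  rewrite /mor_apply /= -[RHS]cats0; congr (_ ++ _).
  by elim: (_ - _).
by rewrite h'0 subnKC.
Qed.

(** * Deciding emptiness from a recursive bound *)

Theorem theorem7 (S1 S2 : desc_system) (c1 c2 : word -> nat) :
  complexity_measure S1 c1 ->
  complexity_measure S2 c2 ->
  effective_trio S1 ->
  effective_trio S2 ->
  decidable_word_problem S1 ->
  ~ decidable_emptiness S1 ->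
  decidable_emptiness S2 ->
  nonrecursive_tradeoff S1 c1 S2 c2.
Proof.
move=> [/(effectiveP (inhabits 0)) [c [cc cP]] _] c2P trio1 trio2.
move=> /decidable_onP [w [cw wP]] undec empt2 [f [[p fP] [_ fB]]].
have cf : computable (fun _ => True) f by exists p => n _; apply: fP.
apply: undec; have [F [cF FP]] := computable_upward_closure trio1.
have [B [cB BP]] := computable_min_length_bound c2P trio2 empt2.
have SF D : ds_mem S1 D -> ds_mem S1 (F D) by move=> /FP [[]].
pose b D := B (f (c (F D))).
apply/decidable_onP; exists (fun D => ~~ w (F D, nseq (b D) 0)); split.
  apply: computable_negb; apply: (computable_comp cw); last exact: SF.
  apply: computable_pair => //; apply: computable_nseq.
  apply: (computable_comp cB) => //; apply: (computable_comp cf) => //.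
  exact: (computable_comp cc).
move=> D SD; have [overF up nonempty] := FP D SD.
have SFD := SF D SD; have [alphF FD_over] := ds_wf SFD.
have upto m n : m <= n -> ds_lang S1 (F D) (nseq m 0) ->
    ds_lang S1 (F D) (nseq n 0).
  by move=> /subnK <-; elim: (n - m) => //= i IHi /IHi /up.
have wE m : w (F D, nseq m 0) <-> ds_lang S1 (F D) (nseq m 0).
  exact: (wP (_, _)).
split=> [/negP nw u Lu|empty]; last first.
  apply/negP => /wE Fb; have [u] : exists u, ds_lang S1 D u.
    by apply/nonempty; exists (b D).
  exact: empty.
have [m /wE wm] : exists m, ds_lang S1 (F D) (nseq m 0).
  by apply/nonempty; exists u.
have [k /wE Fk k_min] := ex_minnP (ex_intro (fun m => w (F D, nseq m 0)) m wm).
have [k0|k_gt0] := posnP k.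
  by apply: nw; apply/wE; apply: upto Fk; rewrite k0.
have [E SE] := trio_in_family_unary_tail trio2 k_gt0.
have tailF : lang_eq
    (Language [:: 0] (fun w => w = nseq (size w) 0 /\ k <= size w))
    (ds_lang S1 (F D)).
  split=> [|v] /=; first by case: overF => _ ->.
  split=> [[Ev le_kv]|Lv]; first by rewrite Ev; apply: upto Fk.
  have [_ alph0] := overF; have := FD_over v Lv.
  rewrite alph0 => /over1P Ev; split=> //; apply: k_min.
  by apply/wE; rewrite -Ev.
(* [E] only shows that the language of [F D] is in the family of [S2]; the bound then gives an
   equivalent [E'] of controlled size. *)
have [||E' [SE' [alphE' LE']] le_E'] := fB (F D) => //.
  exists E; case: SE => SE [alphE LE]; split=> //; split.
    by rewrite alphE; case: tailF.
  by move=> v; rewrite LE; case: tailF.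
(* The word 0^k shows that [E'] describes a non-empty language, so it has some word 0^j with j at
   most [b D]. *)
have [| | |j le_j Ej] := BP (f (c1 (F D))) E' k.
- by split=> //; rewrite alphE'; case: overF.
- exact: le_E'.
- exact/LE'.
apply: nw; apply/wE; apply: (upto j); last exact/LE'.
(* [b] is defined with the computable [c], which agrees with [c1] on descriptors of [S1]. *)
by rewrite /b cP.
Qed.
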